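(* Let $\alpha>1$ and let $K^\alpha$ be the Cantor set defined in the context. Suppose that for each $s\in\mathbb N$ the set $Z_s=(x_{k,s})_{k=1}^{2^s}$ of $2^s$ distinct points of $K^\alpha$ is uniformly distributed on $K^\alpha$. If $\alpha\ge 2$, then $\Lambda_{2^s}(Z_s,K^\alpha)\to 1$ as $s\to\infty$. If $\alpha<2$, then $\Lambda_{2^s}(Z_s,K^\alpha)\to\infty$ as $s\to\infty$.
   Context: Geometrically symmetric Cantor sets: let $(\ell_s)_{s\ge 0}$ be a sequence of positive numbers with $\ell_0=1$ and $3\ell_{s+1}\le \ell_s$ for all $s\ge 0$. Put $E_0=I_{1,0}=[0,1]$; given $E_s=\bigcup_{j=1}^{2^s} I_{j,s}$, a disjoint union of closed intervals (''basic intervals of level $s$'') of length $\ell_s$ (numbered from left to right), $E_{s+1}$ is obtained by replacing each $I_{j,s}$ by two closed subintervals $I_{2j-1,s+1}$ and $I_{2j,s+1}$ of length $\ell_{s+1}$, the first sharing the left endpoint and the second the right endpoint of $I_{j,s}$. The associated Cantor set is $K=\bigcap_{s\ge0}E_s$. The set $K^\alpha$ ($\alpha>1$) is the Cantor set associated with $\ell_0=1$, $\ell_s=\ell_1^{\alpha^{s-1}}$ for $s\ge1$, where $\ell_1>0$ is a fixed number with $\ell_1\le 1/3$ and $\ell_1^{\alpha-1}\le 1/3$ (equivalently $\alpha\ge(\log\ell_1-\log 3)/\log\ell_1$). Uniform distribution: for a finite set $Z\subset K$ let $m_{j,k}(Z)=\#(Z\cap I_{j,k})$. $Z$ is uniformly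 distributed on $K$ if $|m_{i,k}(Z)-m_{j,k}(Z)|\le 1$ for every $k\in\mathbb N$ and all $i,j\in\{1,\dots,2^k\}$. Lebesgue constant: for a set $Z=\{x_1,\dots,x_N\}$ of $N$ distinct points of a compact set $K\subset\mathbb R$, let $l_k(x)=\prod_{i\ne k}\frac{x-x_i}{x_k-x_i}$ ($1\le k\le N$) and $\Lambda_N(Z,K)=\sup_{x\in K}\sum_{k=1}^N|l_k(x)|$. *)

(* Defs.v *)
From HB Require Import structures.
From mathcomp Require Import all_boot all_order all_algebra finmap.
From mathcomp Require Import all_classical all_reals all_analysis.

Set Implicit Arguments.
Unset Strict Implicit.
Unset Printing Implicit Defensive.

Import Order.TTheory GRing.Theory Num.Theory.
Import numFieldNormedType.Exports.

Local Open Scope classical_set_scope.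
Local Open Scope ring_scope.

(* The basic intervals of level [s] are numbered from left to right by
   [j < 2 ^ s], starting from 0: the children of the [j]-th interval of level
   [s] are the intervals [2 * j] (sharing its left endpoint) and [2 * j + 1]
   (sharing its right endpoint) of level [s.+1]. *)
Fixpoint left_endpoint (R : realType) (ell : nat -> R) (s j : nat) : R :=
  if s is s'.+1 then
    if odd j then left_endpoint ell s' j./2 + ell s' - ell s'.+1
    else left_endpoint ell s' j./2
  else 0.

Definition basic_interval (R : realType) (ell : nat -> R) (s j : nat) :
    interval R :=
  `[left_endpoint ell s j, left_endpoint ell s j + ell s].

Definition cantor_level (R : realType) (ell : nat -> R) (s : nat) : set R :=
  \bigcup_(j < 2 ^ s) [set` basic_interval ell s j].

(* Meaningful when [ell 0 = 1], [0 < ell s] and [3 * ell s.+1 <= ell s]. *)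
Definition cantor_set_of (R : realType) (ell : nat -> R) : set R :=
  \bigcap_s cantor_level ell s.

Definition alpha_lengths (R : realType) (alpha ell1 : R) (s : nat) : R :=
  if s is s'.+1 then ell1 `^ (alpha ^+ s') else 1.

Definition interval_count (R : realType) (ell : nat -> R) (Z : {fset R})
    (s j : nat) : nat :=
  #|` [fset z in Z | z \in basic_interval ell s j]%fset|.

Definition uniformly_distributed (R : realType) (ell : nat -> R)
    (Z : {fset R}) : Prop :=
  forall k i j : nat, (i < 2 ^ k)%N -> (j < 2 ^ k)%N ->
    (`|interval_count ell Z k i - interval_count ell Z k j| <= 1)%N.

(* The fundamental Lagrange polynomial of the node [z] of [Z]. *)
Definition lagrange_basis (R : realType) (Z : {fset R}) (z x : R) : R :=
  \prod_(w <- Z | w != z) ((x - w) / (z - w)).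

(* On a nonempty compact [K] the supremum is finite, so that the default value
   of [sup] plays no role. *)
Definition lebesgue_constant (R : realType) (Z : {fset R}) (K : set R) : R :=
  sup [set \sum_(z <- Z) `|lagrange_basis Z z x| | x in K].

(* Main.v *)
Require Import Defs.
From HB Require Import structures.
From mathcomp Require Import all_boot all_order all_algebra finmap.
From mathcomp Require Import all_classical all_reals all_analysis.
From mathcomp Require Import zify ring lra.

(* By uniformity [Z s] has exactly one node in each basic interval of level [s].
   The nodes other than the one nearest to [x] split into sibling blocks of
   heights [h < s], at distance comparable to [ell (s - h - 1)] from [x], so a
   fundamental polynomial is governed by the ratio of two products over such
   blocks, one for [x] and one for its node.

   For [alpha >= 2], splitting each sibling block into two halves bounds that
   ratio by [3 * 79 ^ (2 ^ (s - 3))], whereas [ell s] is about at most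
   [81 ^ - (2 ^ (s - 3))], so distant nodes are negligible; the few nodes close
   to the nearest one contribute [O (ell s / ell (s - 1))], and the nearest one
   at most [1 + o (1)].  The Lebesgue constant is at least [1] since it is the
   supremum of a function equal to [1] at every node.

   For [alpha < 2], take [x] in the first interval of level [s] and the node [z]
   in the mirror image of that interval in the left half of the Cantor set.  The
   nodes of the left half contribute equally to both up to a bounded factor, but
   those of the right half are uniformly closer to [z], which gains a factor
   [(1 + ell 1 / 3) ^ (2 ^ (s - 1))]; this beats [ell s], of order
   [exp (- C * alpha ^ s)]. *)

Set Implicit Arguments.
Unset Strict Implicit.
Unset Printing Implicit Defensive.

Import Order.TTheory GRing.Theory Num.Theory.
Import numFieldNormedType.Exports.

Local Open Scope classical_set_scope.
Local Open Scope ring_scope.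

(** * Dyadic sibling blocks *)

Definition sib (p : nat) : nat := if odd p then p.-1 else p.+1.

Lemma half_sib p : (sib p)./2 = p./2.
Proof. by rewrite /sib; case: ifP => pP; lia. Qed.

Lemma odd_sib p : odd (sib p) = ~~ odd p.
Proof. by rewrite /sib; case: ifP => pP; lia. Qed.

Lemma sib_lt n p : (p < 2 ^ n.+1)%N -> (sib p < 2 ^ n.+1)%N.
Proof. by rewrite expnS /sib; case: ifP => pP; lia. Qed.

Lemma divn_expS j h : (j %/ 2 ^ h.+1 = (j %/ 2 ^ h)./2)%N.
Proof. by rewrite expnSr divnMA divn2. Qed.

Lemma divn_block j h p :
  (p * 2 ^ h <= j < p.+1 * 2 ^ h)%N = (j %/ 2 ^ h == p)%N.
Proof.
have e0 : (0 < 2 ^ h)%N by rewrite expn_gt0.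
by rewrite eqn_leq andbC leq_divRL // -(ltnS _ p) ltn_divLR.
Qed.

(** The indices [j] with [j %/ 2 ^ h = p]: the descendants, [h] generations down, of the interval
    [p]. *)
Definition block {T : Type} {idx : T} (op : T -> T -> T) (F : nat -> T)
    (h p : nat) : T :=
  \big[op/idx]_(p * 2 ^ h <= j < p.+1 * 2 ^ h) F j.

(* The dyadic block of height [h] around [i] is the disjoint union of [{i}]
   and of the sibling blocks of heights below [h]. *)
Lemma big_sib (T : Type) (idx : T) (op : Monoid.com_law idx) (F : nat -> T)
    s i : (i < 2 ^ s)%N ->
  \big[op/idx]_(0 <= j < 2 ^ s | j != i) F j =
  \big[op/idx]_(h < s) block (idx := idx) op F h (sib (i %/ 2 ^ h)).
Proof.
move=> i_lt.
have main h : \big[op/idx]_((i %/ 2 ^ h) * 2 ^ h <= j <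
      (i %/ 2 ^ h).+1 * 2 ^ h | j != i) F j =
    \big[op/idx]_(h' < h) block (idx := idx) op F h' (sib (i %/ 2 ^ h')).
  elim: h => [|h IH].
    rewrite big_ord0 expn0 divn1 !muln1 big_ltn_cond //= eqxx /=.
    by rewrite big_geq.
  rewrite big_ord_recr /= -IH divn_expS.
  set p := (i %/ 2 ^ h)%N.
  (* [i] lies in block [p], not in its sibling, so the condition [j != i] is vacuous there. *)
  have sibF : block (idx := idx) op F h (sib p) =
      \big[op/idx]_(sib p * 2 ^ h <= j < (sib p).+1 * 2 ^ h | j != i) F j.
    rewrite /block big_nat_cond [RHS]big_nat_cond; apply: eq_bigl => j.
    rewrite divn_block; case: eqP => //= jp; case: eqP => // ji.
    move: jp; rewrite ji -/p => /(congr1 odd).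
    by rewrite odd_sib; case: odd.
  rewrite sibF; have pE := odd_double_half p.
  have [e1 e2] : (p./2 * 2 ^ h.+1 = p./2.*2 * 2 ^ h)%N /\
      (p./2.+1 * 2 ^ h.+1 = (p./2.*2).+2 * 2 ^ h)%N.
    by rewrite expnS; split; nia.
  rewrite e1 e2.
  (* The parent block is cut in its middle; the parity of [p] decides which half is the sibling. *)
  rewrite (@big_cat_nat _ _ _ (p./2.*2.+1 * 2 ^ h)) ?leq_mul2r ?leqnSn ?orbT//.
  rewrite /sib; case: ifP pE => oddp pE.
    have -> : (p.-1 = p./2.*2)%N by lia.
    have -> : (p = p./2.*2.+1)%N by lia.
    rewrite /= uphalf_double; exact: Monoid.mulmC.
  by have -> : (p = p./2.*2)%N by []; rewrite doubleK.
by rewrite -main divn_small // mul0n mul1n.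
Qed.

Lemma block_prod_le (R : realDomainType) (F : nat -> R) h p b :
  (forall j, (j %/ 2 ^ h = p)%N -> 0 <= F j <= b) ->
  block (idx := 1) *%R F h p <= b ^+ (2 ^ h).
Proof.
move=> Fb; apply: (@le_trans _ _ (block (idx := 1) *%R (fun=> b) h p)).
  rewrite /block big_nat [leRHS]big_nat; apply: ler_prod => j.
  by rewrite divn_block => /eqP /Fb.
by rewrite /block prodr_const_nat -mulnBl subSnn mul1n.
Qed.

Lemma block_prod_ge (R : realDomainType) (F : nat -> R) h p b :
  0 <= b -> (forall j, (j %/ 2 ^ h = p)%N -> b <= F j) ->
  b ^+ (2 ^ h) <= block (idx := 1) *%R F h p.
Proof.
move=> b0 Fb; apply: (@le_trans _ _ (block (idx := 1) *%R (fun=> b) h p)).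
  by rewrite /block prodr_const_nat -mulnBl subSnn mul1n.
rewrite /block big_nat [leRHS]big_nat; apply: ler_prod => j.
by rewrite divn_block => /eqP /Fb ->; rewrite b0.
Qed.

Lemma block_sum_le (R : realDomainType) (F : nat -> R) h p b :
  (forall j, (j %/ 2 ^ h = p)%N -> F j <= b) ->
  block (idx := 0) +%R F h p <= b *+ (2 ^ h).
Proof.
move=> Fb; apply: (@le_trans _ _ (block (idx := 0) +%R (fun=> b) h p)).
  rewrite /block big_nat [leRHS]big_nat; apply: ler_sum => j.
  by rewrite divn_block => /eqP /Fb.
by rewrite /block sumr_const_nat -mulnBl subSnn mul1n.
Qed.

Lemma block_halves (T : Type) (idx : T) (op : Monoid.law idx) (F : nat -> T)
    h p :
  block (idx := idx) op F h.+1 p =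
  op (block (idx := idx) op F h p.*2) (block (idx := idx) op F h p.*2.+1).
Proof.
rewrite /block (@big_cat_nat _ _ _ (p.*2.+1 * 2 ^ h)) /=; last 2 first.
- by rewrite expnS; nia.
- by rewrite expnS; nia.
by congr (op _ _); congr bigop; congr index_iota; rewrite expnS; nia.
Qed.

(** * Geometry of the basic intervals *)

Lemma sib_block_lt h m i j : (i < 2 ^ (h + m.+1))%N ->
  (j %/ 2 ^ h = sib (i %/ 2 ^ h))%N -> (j < 2 ^ (h + m.+1))%N.
Proof.
have e0 : (0 < 2 ^ h)%N by rewrite expn_gt0.
rewrite expnD mulnC -!ltn_divLR // => ilt ->; exact: sib_lt.
Qed.

Section CantorGeometry.
Variables (R : realType) (ell : nat -> R).
Hypothesis ell0 : ell 0%N = 1.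
Hypothesis ell_gt0 : forall m, 0 < ell m.
Hypothesis ell3 : forall m, 3 * ell m.+1 <= ell m.

Local Notation I := (basic_interval ell).
Local Notation L := (left_endpoint ell).

Lemma basic_itvE m j x : (x \in I m j) = (L m j <= x <= L m j + ell m).
Proof. by rewrite in_itv. Qed.

Lemma basic_itv_parent m j x : x \in I m.+1 j -> x \in I m j./2.
Proof.
rewrite !basic_itvE /=; have := ell3 m; have := ell_gt0 m.+1.
by case: odd => ? ? /andP[? ?]; apply/andP; split; lra.
Qed.

Lemma basic_itv_ancestor h m j x :
  x \in I (h + m) j -> x \in I m (j %/ 2 ^ h).
Proof.
elim: h m => [|h IH] m; first by rewrite divn1.
by rewrite addSnnS => /IH /basic_itv_parent; rewrite divn_expS.
Qed.

Lemma ell_anti m n : (m <= n)%N -> ell n <= ell m.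
Proof.
move=> /subnK <-; elim: (n - m)%N => // k IH.
have := ell3 (k + m); have := ell_gt0 (k + m).+1; rewrite addSn; lra.
Qed.

(** Siblings sit at the two ends of an interval of length [ell m], with a gap of length
    [ell m - ell m.+1 *+ 2] between them. *)
Lemma dist_sib m p x w : x \in I m.+1 p -> w \in I m.+1 (sib p) ->
  ell m - ell m.+1 *+ 2 <= `|x - w| <= ell m.
Proof.
rewrite !basic_itvE /= odd_sib half_sib; have := ell3 m.
have := ell_gt0 m.+1.
case: odd => /= e0 e3 /andP[? ?] /andP[? ?].
- by rewrite ger0_norm; [apply/andP; split|]; lra.
- by rewrite ler0_norm; [apply/andP; split|]; lra.
Qed.

Lemma dist_sib_ge m p x w : x \in I m.+1 p -> w \in I m.+1 (sib p) ->
  ell m / 3 <= `|x - w|.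
Proof. by move=> xp /(dist_sib xp) /andP[+ _]; have := ell3 m; lra. Qed.

(* The half of the sibling interval with index [odd (sib p)] is the one lying
   farther from [x]. *)
Lemma dist_sib_child m p (c : bool) x w :
    x \in I m.+1 p -> w \in I m.+2 (c + (sib p).*2) ->
  if c == odd (sib p) then
    ell m - ell m.+1 - ell m.+2 <= `|x - w| <= ell m
  else
    ell m - ell m.+1 *+ 2 <= `|x - w| <= ell m - ell m.+1 + ell m.+2.
Proof.
rewrite !basic_itvE /= oddD odd_double addbF half_bit_double.
rewrite oddb /= !odd_sib half_sib.
have := ell3 m; have := ell3 m.+1; have := ell_gt0 m.+2.
case: odd; case: c => /= e0 e3 e4 /andP[? ?] /andP[? ?].
- by rewrite ger0_norm; [apply/andP; split|]; lra.
- by rewrite ger0_norm; [apply/andP; split|]; lra.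
- by rewrite ler0_norm; [apply/andP; split|]; lra.
- by rewrite ler0_norm; [apply/andP; split|]; lra.
Qed.

(** Two distinct intervals either are siblings or have distinct parents, for which induction gives a
    larger bound. *)
Lemma basic_itv_sep m i j x w : (i < 2 ^ m.+1)%N -> (j < 2 ^ m.+1)%N ->
  i != j -> x \in I m.+1 i -> w \in I m.+1 j -> ell m / 3 <= `|x - w|.
Proof.
elim: m i j => [|m IH] i j ilt jlt ij xi wj.
- apply: (dist_sib_ge xi); suff -> : sib i = j by [].
  by move: ij ilt jlt; rewrite /sib; case: ifP; lia.
- have [ij2|ij2] := eqVneq i./2 j./2.
    apply: (dist_sib_ge xi); suff -> : sib i = j by [].
    by move: ij ij2; rewrite /sib; case: ifP; lia.
  apply: le_trans (IH i./2 j./2 _ _ ij2 (basic_itv_parent xi)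
    (basic_itv_parent wj)).
  + by have := ell3 m; have := ell_gt0 m.+1; lra.
  + by move: ilt; rewrite (expnS _ m.+1); lia.
  + by move: jlt; rewrite (expnS _ m.+1); lia.
Qed.

Lemma basic_itv_inj m i j x : (i < 2 ^ m)%N -> (j < 2 ^ m)%N ->
  x \in I m i -> x \in I m j -> i = j.
Proof.
case: m => [|m] ilt jlt xi xj; first by move: ilt jlt; rewrite expn0; lia.
apply: contraTeq isT => ij; have := basic_itv_sep ilt jlt ij xi xj.
by rewrite subrr normr0 leNgt divr_gt0 // ell_gt0.
Qed.

Lemma cantor_level_index x s : cantor_level ell s x ->
  exists2 i, (i < 2 ^ s)%N & x \in I s i.
Proof. by move=> [i /= ? ?]; exists i. Qed.

Lemma cantor_set_itv01 x : cantor_set_of ell x -> 0 <= x <= 1.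
Proof.
move=> /(_ 0%N Logic.I) /cantor_level_index[i _].
by rewrite basic_itvE /= add0r ell0.
Qed.

Lemma left_endpoint0 k : L k 0 = 0.
Proof. by elim: k => //= k ->. Qed.

(** The reflection of [[0, ell c]] reverses the order of its [2 ^ n] descendants and turns right
    endpoints into left ones. *)
Lemma left_endpoint_mirror n c j : (j < 2 ^ n)%N ->
  L (n + c) (2 ^ n - 1 - j)%N = ell c - ell (n + c) - L (n + c) j.
Proof.
elim: n j => [|n IH] j jlt.
  have -> : j = 0%N by lia.
  by rewrite sub0n left_endpoint0; lra.
have e : (0 < 2 ^ n)%N by rewrite expn_gt0.
rewrite expnS in jlt *; rewrite addSn /=.
have -> : ((2 * 2 ^ n - 1 - j)./2 = 2 ^ n - 1 - j./2)%N by lia.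
have -> : odd (2 * 2 ^ n - 1 - j) = ~~ odd j by lia.
rewrite IH; last by lia.
by case: odd => /=; lra.
Qed.

Lemma cantor_set0 : cantor_set_of ell 0.
Proof.
move=> s _; exists 0%N; first by rewrite /= expn_gt0.
by rewrite /= basic_itvE left_endpoint0 lexx add0r ltW.
Qed.

Lemma cantor_set_ell s : cantor_set_of ell (ell s).
Proof.
move=> m _; have [ms|/ltnW sm] := leqP m s.
  exists 0%N; first by rewrite /= expn_gt0.
  by rewrite /= basic_itvE left_endpoint0 add0r ltW //= ell_anti.
(* At levels beyond [s], [ell s] is the right endpoint of the last descendant of the first
   interval. *)
exists (2 ^ (m - s) - 1 - 0)%N.
  by rewrite /= subn0 subn1 prednK ?expn_gt0 // leq_exp2l // leq_subr.
have := left_endpoint_mirror s (expn_gt0 2 (m - s)).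
rewrite subnK // left_endpoint0 /= basic_itvE => ->; have := ell_gt0 m.
by move=> ?; apply/andP; split; lra.
Qed.

(** The terms are dominated by the powers of 2/3, which sum to 3. In the induction, the sum [S]
    becomes [1 + 2 * r * S] with a ratio [r] of consecutive lengths, at most 1/3. *)
Lemma geometric_ell_sum n :
  \sum_(i < n.+1) 2 ^+ i * (ell n / ell (n - i)%N) <= 3.
Proof.
elim: n => [|n IH].
  by rewrite big_ord1 expr0 mul1r subn0 divff ?gt_eqF // ler1n.
rewrite big_ord_recl expr0 mul1r subn0 divff ?gt_eqF //.
under eq_bigr => i _.
  rewrite /= /bump /= add1n exprS subSS.
  have -> : 2 * 2 ^+ i * (ell n.+1 / ell (n - i)%N) =
    (2 * (ell n.+1 / ell n)) * (2 ^+ i * (ell n / ell (n - i)%N)) :> R.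
    by field; rewrite !gt_eqF.
  over.
rewrite -mulr_sumr; have r0 : 0 < ell n.+1 / ell n by rewrite divr_gt0.
have r3 : ell n.+1 / ell n <= 3^-1.
  by rewrite ler_pdivrMr //; have := ell3 n; lra.
by nra.
Qed.

End CantorGeometry.

(** * Products of distances to the nodes *)

(* Meant for [x] in the [i]-th basic interval of the level indexing the nodes
   [f], where block [i %/ 2 ^ h] of height [h] is the set of nodes lying in the
   basic interval [h] levels up. *)
Definition sib_prod (R : realType) (f : nat -> R) (h i : nat) (x : R) : R :=
  block (idx := 1) *%R (fun j => `|x - f j|) h (sib (i %/ 2 ^ h)).

(** By [big_sib] this is, for [i < 2 ^ s], the product of the distances from [x] to all nodes except
    [f i]. *)
Definition node_prod (R : realType) (f : nat -> R) (s i : nat) (x : R) : R :=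
  \prod_(h < s) sib_prod f h i x.

Section NodeProducts.
Variables (R : realType) (ell : nat -> R).
Hypothesis ell_gt0 : forall m, 0 < ell m.
Hypothesis ell3 : forall m, 3 * ell m.+1 <= ell m.
Variables (f : nat -> R) (s : nat).

Local Notation I := (basic_interval ell).

Hypothesis fP : forall j, (j < 2 ^ s)%N -> f j \in I s j.

(** The equation [s = h + m.+1] converts heights into levels: blocks of height [h] are intervals of
    level [m.+1], whose parents have length [ell m]. *)
Lemma sib_nodeP h m i j : s = (h + m.+1)%N -> (i < 2 ^ s)%N ->
  (j %/ 2 ^ h = sib (i %/ 2 ^ h))%N -> f j \in I m.+1 (sib (i %/ 2 ^ h)).
Proof.
move=> sE ilt jE; rewrite -jE; apply: basic_itv_ancestor => //.
by rewrite -sE; apply: fP; rewrite sE; apply: (sib_block_lt _ jE); rewrite -sE.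
Qed.

Lemma dist_sib_node h m i j x : s = (h + m.+1)%N -> (i < 2 ^ s)%N ->
  x \in I s i -> (j %/ 2 ^ h = sib (i %/ 2 ^ h))%N ->
  ell m / 3 <= `|x - f j| <= ell m.
Proof.
move=> sE ilt xi jE; have fj := sib_nodeP sE ilt jE.
have xi' : x \in I m.+1 (i %/ 2 ^ h) by apply: basic_itv_ancestor; rewrite -?sE.
rewrite (dist_sib_ge ell_gt0 ell3 xi' fj).
by case/andP: (dist_sib ell_gt0 ell3 xi' fj).
Qed.

Lemma sib_prod_gt0 h i x : (h < s)%N -> (i < 2 ^ s)%N -> x \in I s i ->
  0 < sib_prod f h i x.
Proof.
move=> hs ilt xi; have sE : s = (h + (s - h.+1).+1)%N by lia.
apply: lt_le_trans (_ : (ell (s - h.+1)%N / 3) ^+ (2 ^ h) <= _).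
  by rewrite exprn_gt0 // divr_gt0.
apply: block_prod_ge => [|j jE]; first by rewrite divr_ge0 // ltW.
by case/andP: (dist_sib_node sE ilt xi jE).
Qed.

Lemma node_prod_gt0 i x : (i < 2 ^ s)%N -> x \in I s i ->
  0 < node_prod f s i x.
Proof. by move=> ? ?; apply: prodr_gt0 => h _; exact: sib_prod_gt0. Qed.

(** All [2 ^ h] distances lie between [ell m / 3] and [ell m], wherever the two points are. *)
Lemma sib_prod_crude h i j x z : (h < s)%N -> (i < 2 ^ s)%N -> (j < 2 ^ s)%N ->
  x \in I s i -> z \in I s j ->
  sib_prod f h i x <= 3 ^+ (2 ^ h) * sib_prod f h j z.
Proof.
move=> hs ilt jlt xi zj; have sE : s = (h + (s - h.+1).+1)%N by lia.
set m := (s - h.+1)%N in sE.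
apply: (@le_trans _ _ (ell m ^+ (2 ^ h))).
  apply: block_prod_le => k kE; rewrite normr_ge0.
  by case/andP: (dist_sib_node sE ilt xi kE).
have -> : ell m = 3 * (ell m / 3) by field.
rewrite exprMn ler_pM2l ?exprn_gt0 //.
apply: block_prod_ge => [|k kE]; first by rewrite divr_ge0 // ltW.
by case/andP: (dist_sib_node sE jlt zj kE).
Qed.

(** The far and near halves of the sibling block are bounded separately. The far upper bound is
    compared with the near lower bound (factor [b2]) and the near upper bound with the far lower
    bound (factor [b1]), so a pair of nodes costs only [b1 * b2]. *)
Lemma sib_prod_refined h m b1 b2 i j x z : s = (h + m.+2)%N ->
  ell m - ell m.+1 + ell m.+2 <= b1 * (ell m - ell m.+1 - ell m.+2) ->
  ell m <= b2 * (ell m - ell m.+1 *+ 2) ->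
  (i < 2 ^ s)%N -> (j < 2 ^ s)%N -> x \in I s i -> z \in I s j ->
  sib_prod f h.+1 i x <= (b1 * b2) ^+ (2 ^ h) * sib_prod f h.+1 j z.
Proof.
move=> sE hb1 hb2 ilt jlt xi zj.
have := ell_gt0 m.+1; have := ell_gt0 m.+2; have := ell3 m; have := ell3 m.+1.
move=> e3' e3 e2 e1.
have sE' : s = (h.+1 + m.+1)%N by rewrite sE addnS.
have dist (c : bool) k a y : (a < 2 ^ s)%N -> y \in I s a ->
    (k %/ 2 ^ h = c + (sib (a %/ 2 ^ h.+1)).*2)%N ->
    if c == odd (sib (a %/ 2 ^ h.+1)) then
      ell m - ell m.+1 - ell m.+2 <= `|y - f k| <= ell m
    else
      ell m - ell m.+1 *+ 2 <= `|y - f k| <= ell m - ell m.+1 + ell m.+2.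
  move=> alt ya kE; apply: dist_sib_child => //.
    by apply: basic_itv_ancestor; rewrite -?sE'.
  rewrite -kE; apply: basic_itv_ancestor => //; rewrite -sE; apply: fP.
  have kE' : (k %/ 2 ^ h.+1 = sib (a %/ 2 ^ h.+1))%N.
    by rewrite divn_expS kE half_bit_double.
  by rewrite sE'; apply: sib_block_lt kE'; rewrite -sE'.
have halves a y : sib_prod f h.+1 a y =
    block (idx := 1) *%R (fun k => `|y - f k|) h
      (odd (sib (a %/ 2 ^ h.+1)) + (sib (a %/ 2 ^ h.+1)).*2) *
    block (idx := 1) *%R (fun k => `|y - f k|) h
      (~~ odd (sib (a %/ 2 ^ h.+1)) + (sib (a %/ 2 ^ h.+1)).*2).
  by rewrite /sib_prod block_halves; case: odd => //=; rewrite mulrC.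
have upper : sib_prod f h.+1 i x <=
    ell m ^+ (2 ^ h) * (ell m - ell m.+1 + ell m.+2) ^+ (2 ^ h).
  rewrite halves; apply: ler_pM.
  - by apply: prodr_ge0 => k _; exact: normr_ge0.
  - by apply: prodr_ge0 => k _; exact: normr_ge0.
  - apply: block_prod_le => k kE; rewrite normr_ge0.
    by move: (dist _ _ _ _ ilt xi kE); rewrite eqxx => /andP[].
  - apply: block_prod_le => k kE; rewrite normr_ge0.
    by move: (dist _ _ _ _ ilt xi kE); case: odd => /= /andP[].
have lower : (ell m - ell m.+1 - ell m.+2) ^+ (2 ^ h) *
    (ell m - ell m.+1 *+ 2) ^+ (2 ^ h) <= sib_prod f h.+1 j z.
  rewrite halves; apply: ler_pM.
  - by rewrite exprn_ge0 //; lra.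
  - by rewrite exprn_ge0 //; lra.
  - apply: block_prod_ge => [|k kE]; first by lra.
    by move: (dist _ _ _ _ jlt zj kE); rewrite eqxx => /andP[].
  - apply: block_prod_ge => [|k kE]; first by lra.
    by move: (dist _ _ _ _ jlt zj kE); case: odd => /= /andP[].
have b1_gt0 : 0 < b1.
  have : 0 < b1 * (ell m - ell m.+1 - ell m.+2) by lra.
  by rewrite pmulr_lgt0 //; lra.
have b2_gt0 : 0 < b2.
  have : 0 < b2 * (ell m - ell m.+1 *+ 2) by lra.
  by rewrite pmulr_lgt0 //; lra.
apply: (le_trans upper); rewrite -exprMn.
apply: le_trans (ler_wpM2l (exprn_ge0 _ (ltW (mulr_gt0 b1_gt0 b2_gt0))) lower).
rewrite -!exprMn; apply: lerXn2r; rewrite ?nnegrE.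
- by rewrite mulr_ge0 //; lra.
- by rewrite !mulr_ge0 //; lra.
- have -> u v : b1 * b2 * (u * v) = (b2 * v) * (b1 * u) by ring.
  by apply: ler_pM => //; lra.
Qed.

(** Both points have the same sibling block. Moving from [z] to [x] changes a distance by at most
    [d], while the distance from [z] is at least [ell m / 3]: each factor grows by at most
    [1 + 3 * (d / ell m)]. *)
Lemma sib_prod_close h i j x z d :
  (h < s)%N -> (i < 2 ^ s)%N -> (j < 2 ^ s)%N ->
  x \in I s i -> z \in I s j -> (i %/ 2 ^ h = j %/ 2 ^ h)%N -> `|x - z| <= d ->
  sib_prod f h i x <=
  expR (3 * (2 ^+ h * (d / ell (s - h.+1)%N))) * sib_prod f h j z.
Proof.
move=> hs ilt jlt xi zj ij xzd; have sE : s = (h + (s - h.+1).+1)%N by lia.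
set m := (s - h.+1)%N in sE *.
rewrite /sib_prod ij.
have -> : expR (3 * (2 ^+ h * (d / ell m))) =
    block (idx := 1) *%R (fun=> expR (3 * (d / ell m))) h (sib (j %/ 2 ^ h)).
  rewrite /block prodr_const_nat -mulnBl subSnn mul1n -expRM_natl -natrX.
  by congr expR; ring.
rewrite /block -big_split /= big_nat [leRHS]big_nat.
apply: ler_prod => k; rewrite divn_block => /eqP kE; rewrite normr_ge0 /=.
have /andP[zk _] := dist_sib_node sE jlt zj kE.
have d0 : 0 <= d by apply: le_trans xzd.
apply: (@le_trans _ _ ((1 + 3 * (d / ell m)) * `|z - f k|)); last first.
  by rewrite ler_wpM2r // expR_ge1Dx.
have -> : x - f k = (x - z) + (z - f k) by ring.
apply: (le_trans (ler_normD _ _)); rewrite mulrDl mul1r addrC lerD2l.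
apply: (le_trans xzd).
have e0 := ell_gt0 m.
have -> : 3 * (d / ell m) * `|z - f k| = d * (`|z - f k| * 3 / ell m) by ring.
by rewrite ler_peMr // ler_pdivlMr // mul1r -ler_pdivrMr.
Qed.

End NodeProducts.

(** * Comparison of the full node products of two points *)

Lemma prod_expr_pow2 (R : comPzSemiRingType) (b : R) n :
  \prod_(h < n) b ^+ (2 ^ h) = b ^+ (2 ^ n - 1).
Proof.
elim: n => [|n IH]; first by rewrite big_ord0 expr0.
rewrite big_ord_recr /= IH -exprD; congr (_ ^+ _).
by have := expn_gt0 2 n; rewrite expnS; lia.
Qed.

Section NodeProductRatios.
Variables (R : realType) (ell : nat -> R).
Hypothesis ell_gt0 : forall m, 0 < ell m.
Hypothesis ell3 : forall m, 3 * ell m.+1 <= ell m.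
Variables (f : nat -> R) (s : nat).

Local Notation I := (basic_interval ell).

Hypothesis fP : forall j, (j < 2 ^ s)%N -> f j \in I s j.

(** Below height [J] the crude bound costs 3 per node. From height [J] on the two points share their
    blocks and are within [ell n.+1] of each other, so [sib_prod_close] applies; its exponents are
    summed by [geometric_ell_sum], whence [9 = 3 * 3]. *)
Lemma node_prod_close J n i j x z : s = (J + n.+1)%N ->
  (i < 2 ^ s)%N -> (j < 2 ^ s)%N -> x \in I s i -> z \in I s j ->
  (i %/ 2 ^ J = j %/ 2 ^ J)%N ->
  node_prod f s i x <=
  3 ^+ (2 ^ J - 1) * expR (9 * (2 ^+ J * (ell n.+1 / ell n))) *
    node_prod f s j z.
Proof.
move=> sE ilt jlt xi zj ij.
have xz : `|x - z| <= ell n.+1.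
  have : x \in I n.+1 (i %/ 2 ^ J) by apply: basic_itv_ancestor; rewrite -?sE.
  have : z \in I n.+1 (j %/ 2 ^ J) by apply: basic_itv_ancestor; rewrite -?sE.
  rewrite ij !basic_itvE => /andP[? ?] /andP[? ?].
  by rewrite ler_norml; apply/andP; split; lra.
pose e h := 3 * (2 ^+ h * (ell n.+1 / ell (s - h.+1)%N)).
pose c h := if (h < J)%N then 3 ^+ (2 ^ h) else expR (e h).
have c_ge0 h : 0 <= c h by rewrite /c; case: ifP; rewrite ?expR_ge0 ?exprn_ge0.
apply: (@le_trans _ _ (\prod_(h < s) (c h * sib_prod f h j z))).
  apply: ler_prod => -[h hs] _ /=; rewrite ltW /=; last first.
    exact: (sib_prod_gt0 ell_gt0 ell3 fP).
  rewrite /c; case: ifPn => [_|]; first exact: (sib_prod_crude ell_gt0 ell3 fP).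
  rewrite -leqNgt => Jh; apply: (sib_prod_close ell_gt0 ell3 fP) => //.
  by rewrite -(subnKC Jh) expnD !divnMA ij.
rewrite big_split /= ler_wpM2r //.
  by apply/ltW; exact: (node_prod_gt0 ell_gt0 ell3 fP).
rewrite -(big_mkord xpredT) (@big_cat_nat _ _ _ J) //=; last by lia.
rewrite big_mkord -[X in \prod_(X <= _ < _) _]add0n big_addn big_mkord.
apply: ler_pM.
- exact: prodr_ge0.
- exact: prodr_ge0.
- by rewrite -prod_expr_pow2 le_eqVlt; apply/orP; left; apply/eqP;
    apply: eq_bigr => -[h hJ] _; rewrite /c /= hJ.
have -> : (s - J = n.+1)%N by lia.
have -> : \prod_(h < n.+1) c (h + J)%N = expR (\sum_(h < n.+1) e (h + J)%N).
  rewrite expR_sum; apply: eq_bigr => h _.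
  by rewrite /c ltnNge leq_addl.
rewrite ler_expR.
have -> : \sum_(h < n.+1) e (h + J)%N =
  3 * 2 ^+ J * (ell n.+1 / ell n) *
    \sum_(h < n.+1) 2 ^+ h * (ell n / ell (n - h)%N).
  rewrite mulr_sumr; apply: eq_bigr => -[h hn] _ /=.
  rewrite /e; have -> : (s - (h + J).+1 = n - h)%N by lia.
  by rewrite exprD; field; rewrite !gt_eqF.
have := geometric_ell_sum ell_gt0 ell3 n; set S := \sum_(_ < _) _ => S3.
have -> : 9 * (2 ^+ J * (ell n.+1 / ell n)) =
  3 * 2 ^+ J * (ell n.+1 / ell n) * 3 :> R by ring.
rewrite ler_wpM2l //; apply/ltW.
by rewrite !mulr_gt0 ?invr_gt0 ?exprn_gt0.
Qed.

Hypothesis ell_sq : forall m, 3 ^+ (2 ^ m) * ell m.+2 <= ell m.+1.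

(* The factors [21/5], [57/17] and [657/497] bound the distance ratios at
   levels [0], [1] and [>= 2]; what matters is that
   [(21/5)^2 * (57/17) * (657/497) < 79 < 3^4]. *)
Lemma node_prod_osc n i j x z : s = n.+3 ->
  (i < 2 ^ s)%N -> (j < 2 ^ s)%N -> x \in I s i -> z \in I s j ->
  node_prod f s i x <= 3 * 79 ^+ (2 ^ n) * node_prod f s j z.
Proof.
move=> sE ilt jlt xi zj.
have Q_ge0 h a y : (h < n.+3)%N -> (a < 2 ^ s)%N -> y \in I s a ->
    0 <= sib_prod f h a y.
  by move=> hn ? ?; apply/ltW/(sib_prod_gt0 ell_gt0 ell3 fP) => //; rewrite sE.
(* Height 0 has no halves and gets the crude bound; heights [n.+1] and [n.+2] belong to levels 1 and
   0, where the lengths may decrease only by a factor 3. *)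
have split a y : node_prod f s a y =
    sib_prod f 0 a y * ((\prod_(h < n) sib_prod f h.+1 a y) *
      sib_prod f n.+1 a y * sib_prod f n.+2 a y).
  by rewrite /node_prod sE big_ord_recl !big_ord_recr.
have ell_sq0 := ell_sq 0; have ell_sq1 := ell_sq 1.
rewrite /= ?expr2 ?expr1 in ell_sq0 ell_sq1.
have b0 : sib_prod f 0 i x <= 3 * sib_prod f 0 j z.
  by rewrite -(expr1 3); apply: (sib_prod_crude ell_gt0 ell3 fP); rewrite // sE.
have b1 : sib_prod f n.+1 i x <= (57 / 17) ^+ (2 ^ n) * sib_prod f n.+1 j z.
  (* Extreme case: [ell 2 / ell 1 = 1 / 3] and [ell 3 / ell 2 = 1 / 9]. *)
  have -> : 57 / 17 = 19 / 17 * 3 :> R by field.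
  apply: (sib_prod_refined ell_gt0 ell3 fP (m := 1)) => //.
  - by rewrite sE; lia.
  - by have := ell3 1; have := ell_gt0 3; lra.
  - by have := ell3 1; have := ell_gt0 3; lra.
have b2 : sib_prod f n.+2 i x <=
    (21 / 5) ^+ (2 ^ n.+1) * sib_prod f n.+2 j z.
  (* Extreme case: both ratios of consecutive lengths equal to 1/3. *)
  have -> : 21 / 5 = 7 / 5 * 3 :> R by field.
  apply: (sib_prod_refined ell_gt0 ell3 fP (m := 0)) => //.
  - by rewrite sE; lia.
  - by have := ell3 0; have := ell3 1; have := ell_gt0 2; lra.
  - by have := ell3 0; have := ell_gt0 1; lra.
have b3 : \prod_(h < n) sib_prod f h.+1 i x <=
    (657 / 497) ^+ (2 ^ n) * \prod_(h < n) sib_prod f h.+1 j z.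
  apply: (@le_trans _ _ (\prod_(h < n)
      ((657 / 497) ^+ (2 ^ h) * sib_prod f h.+1 j z))).
    apply: ler_prod => -[h hn] _ /=; rewrite Q_ge0 ?ltnS //=; last by lia.
    (* Extreme case: both ratios equal to 1/9. *)
    have -> : 657 / 497 = 73 / 71 * (9 / 7) :> R by field.
    have ell9 m : 9 * ell m.+3 <= ell m.+2.
      apply: le_trans (ell_sq m.+1); rewrite ler_wpM2r ?(ltW (ell_gt0 _)) //.
      have -> : 9 = 3 ^+ (2 ^ 1) :> R by rewrite expn1 expr2; ring.
      by rewrite ler_eXn2l ?leq_exp2l // ltr1n.
    apply: (sib_prod_refined ell_gt0 ell3 fP (m := (n - h.+1).+2)) => //.
    - by rewrite sE; lia.
    - have := ell9 (n - h.+1)%N; have := ell9 (n - h.+1).+1.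
      by have := ell_gt0 (n - h.+1).+4; lra.
    - by have := ell9 (n - h.+1)%N; have := ell_gt0 (n - h.+1).+3; lra.
  rewrite big_split /= ler_wpM2r //.
    by apply: prodr_ge0 => -[h hn] _ /=; apply: Q_ge0 => //; lia.
  by rewrite prod_expr_pow2 ler_weXn2l ?leq_subr //; lra.
rewrite !split.
have -> u v w t : 3 * 79 ^+ (2 ^ n) * (u * (v * w * t)) =
  3 * u * (79 ^+ (2 ^ n) * (v * w * t)) :> R by ring.
have P_ge0 a y : (a < 2 ^ s)%N -> y \in I s a ->
    0 <= \prod_(h < n) sib_prod f h.+1 a y.
  move=> ? ?; apply: prodr_ge0 => -[h hn] _ /=; apply: Q_ge0 => //.
  by rewrite ltnS (leqW (leqW hn)).
apply: ler_pM => //.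
- exact: Q_ge0.
- by rewrite !mulr_ge0 ?P_ge0 ?Q_ge0.
apply: le_trans (ler_pM _ _ (ler_pM _ _ b3 b1) b2) _;
  rewrite ?mulr_ge0 ?P_ge0 ?Q_ge0 //.
have -> a b c u v w : a * u * (b * v) * (c * w) =
  (a * b * c) * (u * v * w) :> R by ring.
rewrite ler_wpM2r ?mulr_ge0 ?P_ge0 ?Q_ge0 //.
rewrite expnS exprM -!exprMn; apply: lerXn2r; rewrite ?nnegrE; lra.
Qed.

End NodeProductRatios.

(** * Lagrange polynomials on a uniformly distributed set *)

Section UniformNodes.
Variables (R : realType) (ell : nat -> R).
Hypothesis ell_gt0 : forall m, 0 < ell m.
Hypothesis ell3 : forall m, 3 * ell m.+1 <= ell m.
Variables (Z : {fset R}) (s : nat).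
Hypothesis card_Z : #|` Z| = (2 ^ s)%N.
Hypothesis sub_Z : [set` Z] `<=` cantor_set_of ell.
Hypothesis unif_Z : uniformly_distributed ell Z.

Local Notation I := (basic_interval ell).

(** Pigeonhole: if one interval were empty, uniformity would leave at most one point in each of the
    others, hence fewer than [2 ^ s] points. *)
Lemma interval_count_gt0 j : (j < 2 ^ s)%N -> (0 < interval_count ell Z s j)%N.
Proof.
move=> jlt; rewrite lt0n; apply/eqP => cnt0.
have cnt1 k : (k < 2 ^ s)%N -> (interval_count ell Z s k <= 1)%N.
  by move=> klt; have := unif_Z klt jlt; rewrite cnt0; lia.
have idx z : z \in Z -> exists i, (i < 2 ^ s)%N && (z \in I s i).
  move=> /sub_Z /(_ s Logic.I) /cantor_level_index[i ilt zi].
  by exists i; rewrite ilt.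
pose g z := if pselect (z \in Z) is left zZ then xchoose (idx z zZ) else 0%N.
have gP z : z \in Z -> (g z < 2 ^ s)%N && (z \in I s (g z)).
  by move=> zZ; rewrite /g; case: pselect => // p; exact: (xchooseP (idx z p)).
have mem_cnt z : z \in Z -> z \in [fset w in Z | w \in I s (g z)]%fset.
  by move=> zZ; rewrite !inE zZ; case/andP: (gP _ zZ).
have inj_g : {in Z &, injective g}.
  move=> z w zZ wZ gzw; have := cnt1 (g z); have /andP[-> _] := gP _ zZ.
  move=> /(_ isT); apply: contraTeq => zw; rewrite -ltnNge.
  have -> : 2%N = #|` [fset z; w]%fset| by rewrite cardfs2 zw.
  apply: fsubset_leq_card; apply/fsubsetP => u.
  by rewrite in_fset2 => /orP[] /eqP ->; [|rewrite gzw]; exact: mem_cnt.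
have := @uniq_leq_size _ [seq g z | z <- Z] (rem j (iota 0 (2 ^ s))).
rewrite map_inj_in_uniq ?fset_uniq // => /(_ isT) H.
have : (2 ^ s <= (2 ^ s).-1)%N.
  have -> : (2 ^ s).-1 = size (rem j (iota 0 (2 ^ s))).
    by rewrite size_rem ?size_iota // mem_iota.
  rewrite -{1}card_Z -(size_map g (Z : {fset R})); apply: H => _ /mapP[z zZ ->].
  rewrite mem_rem_uniq ?iota_uniq // inE mem_iota add0n leq0n /=.
  have /andP[-> zg] := gP _ zZ; rewrite andbT; apply/eqP => gzj.
  have := mem_cnt _ zZ; rewrite gzj.
  by move: cnt0; rewrite /interval_count => /cardfs0_eq ->; rewrite in_fset0.
by have := expn_gt0 2 s; lia.
Qed.

(** A node is chosen in every interval; disjointness makes the choice injective, and the cardinality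
    of [Z] makes it exhaustive. *)
Lemma uniform_nodes : exists f : nat -> R,
  [/\ forall j, (j < 2 ^ s)%N -> f j \in Z,
      forall j, (j < 2 ^ s)%N -> f j \in I s j,
      {in iota 0 (2 ^ s) &, injective f} &
      perm_eq Z [seq f j | j <- iota 0 (2 ^ s)]].
Proof.
have /choice[f fP] : forall j, exists z,
    (j < 2 ^ s)%N ==> ((z \in Z) && (z \in I s j)).
  move=> j; have [jlt|] := boolP (j < 2 ^ s)%N; last by exists 0.
  have := interval_count_gt0 jlt; rewrite /interval_count cardfs_gt0.
  by move=> /fset0Pn[z]; rewrite !inE /= => zP; exists z.
have fZ j : (j < 2 ^ s)%N -> f j \in Z.
  by move=> jlt; have := fP j; rewrite jlt /= => /andP[].
have fI j : (j < 2 ^ s)%N -> f j \in I s j.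
  by move=> jlt; have := fP j; rewrite jlt /= => /andP[].
have inj_f : {in iota 0 (2 ^ s) &, injective f}.
  move=> i j; rewrite !mem_iota !add0n /= => ilt jlt fij.
  apply: (basic_itv_inj ell_gt0 ell3 ilt jlt (fI _ ilt)).
  by rewrite fij fI.
exists f; split => //.
have uniq_f : uniq [seq f j | j <- iota 0 (2 ^ s)].
  by rewrite map_inj_in_uniq // iota_uniq.
apply: uniq_perm => //.
have sub : {subset [seq f j | j <- iota 0 (2 ^ s)] <= Z}.
  by move=> _ /mapP[j + ->]; rewrite mem_iota add0n => /fZ.
have [|_ eqZ] := uniq_min_size uniq_f sub.
  by rewrite size_map size_iota -card_Z.
by move=> z; rewrite -eqZ.
Qed.

End UniformNodes.

(** * General bounds for Lebesgue constants *)

Section LebesgueSums.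
Variables (R : realType) (Z : {fset R}).

(** Boundedness makes the [sup] a genuine supremum. The numerators are at most 1 because all points
    lie in [[0, 1]]. *)
Lemma lebesgue_sum_ubound (K : set R) :
    (forall x, K x -> 0 <= x <= 1) -> (forall z, z \in Z -> 0 <= z <= 1) ->
  has_ubound [set \sum_(z <- Z) `|lagrange_basis Z z x| | x in K].
Proof.
move=> K01 Z01.
exists (\sum_(z <- Z) \prod_(w <- Z | w != z) `|(z - w)^-1|) => _ [x Kx <-].
rewrite big_seq [leRHS]big_seq; apply: ler_sum => z zZ.
rewrite /lagrange_basis normr_prod.
rewrite big_seq_cond [leRHS]big_seq_cond; apply: ler_prod => w /andP[wZ _].
rewrite normr_ge0 normrM /= ler_piMl //.
have /andP[? ?] := K01 _ Kx; have /andP[? ?] := Z01 _ wZ.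
by rewrite ler_norml; apply/andP; split; lra.
Qed.

Lemma lebesgue_constant_ge (K : set R) x :
    (forall x, K x -> 0 <= x <= 1) -> (forall z, z \in Z -> 0 <= z <= 1) ->
  K x -> \sum_(z <- Z) `|lagrange_basis Z z x| <= lebesgue_constant Z K.
Proof.
move=> K01 Z01 Kx; apply: ub_le_sup; last by exists x.
exact: lebesgue_sum_ubound.
Qed.

Lemma lebesgue_constant_le (K : set R) M : K !=set0 ->
  (forall x, K x -> \sum_(z <- Z) `|lagrange_basis Z z x| <= M) ->
  lebesgue_constant Z K <= M.
Proof.
move=> [x Kx] KM; apply: ge_sup; last by move=> _ [y /KM + <-].
by exists (\sum_(z <- Z) `|lagrange_basis Z z x|); exists x.
Qed.

Lemma lagrange_basis_node z : z \in Z -> lagrange_basis Z z z = 1.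
Proof.
move=> zZ; rewrite /lagrange_basis big1 // => w wz.
by rewrite divff // subr_eq0 eq_sym.
Qed.

Lemma lebesgue_constant_ge1 (K : set R) :
    (forall x, K x -> 0 <= x <= 1) -> [set` Z] `<=` K -> (0 < #|` Z|)%N ->
  1 <= lebesgue_constant Z K.
Proof.
move=> K01 ZK; rewrite cardfs_gt0 => /fset0Pn[z zZ].
apply: le_trans (lebesgue_constant_ge (x := z) K01 _ _) => [||].
- rewrite (big_fsetD1 z) //= lagrange_basis_node // normr1 lerDl.
  exact: sumr_ge0.
- by move=> w /ZK /K01.
- exact: ZK.
Qed.

End LebesgueSums.

(** * Fundamental polynomials as ratios of node products *)

Section LagrangeNodes.
Variables (R : realType) (ell : nat -> R).
Hypothesis ell_gt0 : forall m, 0 < ell m.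
Hypothesis ell3 : forall m, 3 * ell m.+1 <= ell m.
Variables (Z : {fset R}) (s : nat) (f : nat -> R).

Local Notation I := (basic_interval ell).

Hypothesis fP : forall j, (j < 2 ^ s)%N -> f j \in I s j.
Hypothesis f_inj : {in iota 0 (2 ^ s) &, injective f}.
Hypothesis ZE : perm_eq Z [seq f j | j <- iota 0 (2 ^ s)].

Lemma sum_nodes (F : R -> R) :
  \sum_(z <- Z) F z = \sum_(0 <= j < 2 ^ s) F (f j).
Proof. by rewrite (perm_big _ ZE) big_map /index_iota subn0. Qed.

Lemma prod_nodes i (x : R) : (i < 2 ^ s)%N ->
  \prod_(0 <= k < 2 ^ s | k != i) `|x - f k| = node_prod f s i x.
Proof. by move=> ilt; rewrite big_sib. Qed.

Lemma norm_lagrange j x : (j < 2 ^ s)%N ->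
  `|lagrange_basis Z (f j) x| =
  (\prod_(0 <= k < 2 ^ s | k != j) `|x - f k|) / node_prod f s j (f j).
Proof.
move=> jlt; rewrite /lagrange_basis (perm_big _ ZE) big_map normr_prod.
rewrite -prod_nodes // -prodf_div /index_iota subn0.
rewrite big_seq_cond [RHS]big_seq_cond; apply: eq_big => [k|k _].
  have [kin|//] := boolP (k \in iota _ _).
  by rewrite /= (inj_in_eq f_inj) // mem_iota.
by rewrite normrM normfV.
Qed.

Lemma norm_lagrange_near i x : (i < 2 ^ s)%N ->
  `|lagrange_basis Z (f i) x| = node_prod f s i x / node_prod f s i (f i).
Proof. by move=> ilt; rewrite norm_lagrange // prod_nodes. Qed.

(** The numerator omits node [j], whereas [node_prod] at [x] omits the node [i] of its own interval;
    exchanging the two produces the factor [|x - f i| / |x - f j|]. *)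
Lemma norm_lagrange_far i j x : (i < 2 ^ s)%N -> (j < 2 ^ s)%N -> i != j ->
  x \in I s i ->
  `|lagrange_basis Z (f j) x| =
  `|x - f i| / `|x - f j| * (node_prod f s i x / node_prod f s j (f j)).
Proof.
move=> ilt jlt ij xi; rewrite norm_lagrange // mulrA; congr (_ / _).
have xj : `|x - f j| != 0.
  rewrite normr_eq0 subr_eq0; apply: contra_neq ij => xj.
  by apply: (basic_itv_inj ell_gt0 ell3 ilt jlt xi); rewrite xj fP.
have all k : (k < 2 ^ s)%N ->
    \prod_(0 <= l < 2 ^ s) `|x - f l| =
    `|x - f k| * \prod_(0 <= l < 2 ^ s | l != k) `|x - f l|.
  by move=> klt; rewrite (bigD1_seq k) ?iota_uniq // mem_index_iota.
apply: (mulfI xj); rewrite -all // (all i) // -prod_nodes //.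
by field.
Qed.

End LagrangeNodes.

(** * Upper bound for rapidly decreasing lengths *)

Lemma sum_mulrn_pow2 (V : nmodType) (b : V) n :
  \sum_(h < n) b *+ (2 ^ h) = b *+ (2 ^ n - 1).
Proof.
elim: n => [|n IH]; first by rewrite big_ord0 mulr0n.
rewrite big_ord_recr /= IH -mulrnDr; congr (_ *+ _).
by have := expn_gt0 2 n; rewrite expnS; lia.
Qed.

(** This decay beats the number of nodes, a multiple of [2 ^ N]. From [N = 2] on, each squaring
    gains a factor at most [(2 / 3) ^+ 4], below 1/4. *)
Lemma expr_two_thirds_le (R : realFieldType) N :
  (2 / 3 : R) ^+ (2 ^ N) <= 4 / 4 ^+ N.
Proof.
case: N => [|[|N]]; first by rewrite expn0 !expr0 expr1; lra.
  by rewrite expn1 expr1 expr2; lra.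
elim: N => [|N IH].
  by have -> : (2 ^ 2 = 4)%N by []; rewrite expr2 !exprS expr0; lra.
rewrite expnS mulnC exprM expr2.
have q : (2 / 3 : R) ^+ (2 ^ N.+2) <= 4^-1.
  apply: (@le_trans _ _ ((2 / 3) ^+ 4)); last by rewrite !exprS expr0; lra.
  have -> : 4%N = (2 ^ 2)%N by [].
  by apply: ler_wiXn2l; [lra | lra | rewrite leq_exp2l].
have -> : 4 / 4 ^+ N.+3 = 4^-1 * (4 / 4 ^+ N.+2) :> R.
  by rewrite [4 ^+ N.+3]exprS invfM mulrCA.
by apply: ler_pM => //; apply: exprn_ge0; lra.
Qed.

(** Here 79 comes from [node_prod_osc] and 81 is [3 ^+ 4]; the exponent 64 results from cutting the
    heights at 7. The power is computed by repeated squaring, rounding up. *)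
Lemma powers_79_81 (R : realFieldType) : 3 * (79 / 81 : R) ^+ 64 <= 2 / 3.
Proof.
have e (q p r : R) n : 0 <= q -> q ^+ n <= p -> p * p <= r -> q ^+ (n * 2) <= r.
  move=> q0 qp pr; apply: le_trans pr; rewrite exprM expr2.
  by apply: ler_pM; rewrite ?exprn_ge0.
have q0 : 0 <= 79 / 81 :> R by lra.
have q2 : (79 / 81 : R) ^+ 2 <= 952 / 1000 by rewrite expr2; lra.
have q4 : (79 / 81 : R) ^+ 4 <= 907 / 1000 by apply: (e _ _ _ 2 q0 q2); lra.
have q8 : (79 / 81 : R) ^+ 8 <= 823 / 1000 by apply: (e _ _ _ 4 q0 q4); lra.
have q16 : (79 / 81 : R) ^+ 16 <= 678 / 1000 by apply: (e _ _ _ 8 q0 q8); lra.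
have q32 : (79 / 81 : R) ^+ 32 <= 460 / 1000 by apply: (e _ _ _ 16 q0 q16); lra.
have q64 : (79 / 81 : R) ^+ 64 <= 212 / 1000 by apply: (e _ _ _ 32 q0 q32); lra.
by lra.
Qed.

Section SuperSquareLengths.
Variables (R : realType) (ell : nat -> R).
Hypothesis ell_gt0 : forall m, 0 < ell m.
Hypothesis ell3 : forall m, 3 * ell m.+1 <= ell m.
Hypothesis ell_sq : forall m, 3 ^+ (2 ^ m) * ell m.+2 <= ell m.+1.

Local Notation I := (basic_interval ell).

Lemma ell_ratio_small N : ell (N + 9)%N / ell (N + 8)%N <= (2 / 3) ^+ (2 ^ N).
Proof.
rewrite ler_pdivrMr //; have := ell_sq (N + 7); rewrite -!addnS => h.
apply: (@le_trans _ _ (3^-1 ^+ (2 ^ N) * ell (N + 8)%N)); last first.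
  by rewrite ler_wpM2r ?(ltW (ell_gt0 _)) // lerXn2r // ?nnegrE; lra.
rewrite exprVn ler_pdivlMl ?exprn_gt0 //; apply: le_trans h.
rewrite ler_wpM2r ?(ltW (ell_gt0 _)) // ler_weXn2l //; first by lra.
by rewrite leq_exp2l // leq_addr.
Qed.

Lemma ell_pow3_decr m k :
  3 ^+ (2 ^ (m + k)) * ell (m + k).+1 <= 3 ^+ (2 ^ m) * ell m.+1.
Proof.
elim: k => [|k IH]; first by rewrite addn0.
apply: le_trans IH; rewrite addnS expnS mul2n -addnn exprD -mulrA.
by rewrite ler_wpM2l ?exprn_ge0.
Qed.

(** The ratio of lengths is at most [3 ^+ (2 ^ N) / 81 ^+ (2 ^ (N + 6))], so the left side is at
    most [(3 * (79 / 81) ^+ 64) ^+ (2 ^ N)]. *)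
Lemma ell_79_small N :
  ell (N + 9)%N / ell N.+1 * 79 ^+ (2 ^ (N + 6)) <= (2 / 3) ^+ (2 ^ N).
Proof.
have := ell_pow3_decr N 8; rewrite -addnS => h.
have e0 := ell_gt0 N.+1.
have e9 : ell (N + 9)%N / ell N.+1 <= 3 ^+ (2 ^ N) / 3 ^+ (2 ^ (N + 8)).
  by rewrite ler_pdivrMr // mulrAC ler_pdivlMr ?exprn_gt0 // mulrC.
apply: le_trans (ler_wpM2r _ e9) _; first by rewrite exprn_ge0.
have -> : (2 ^ (N + 8) = 2 ^ (N + 6) * 4)%N by rewrite !expnD -mulnA.
rewrite [in X in _ / X]mulnC exprM.
have -> : 3 ^+ 4 = 81 :> R by rewrite !exprS expr0; ring.
rewrite mulrAC -mulrA -exprVn -exprMn expnD [(2 ^ N * _)%N]mulnC exprM -exprMn.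
apply: lerXn2r; rewrite ?nnegrE.
- by rewrite mulr_ge0 // exprn_ge0.
- by rewrite divr_ge0.
- exact: powers_79_81.
Qed.

Lemma lebesgue_sum_le : exists C : R, 0 <= C /\
  forall N (f : nat -> R) (Z : {fset R}) x,
    (forall j, (j < 2 ^ (N + 9))%N -> f j \in I (N + 9) j) ->
    {in iota 0 (2 ^ (N + 9)) &, injective f} ->
    perm_eq Z [seq f j | j <- iota 0 (2 ^ (N + 9))] ->
    cantor_set_of ell x ->
  \sum_(z <- Z) `|lagrange_basis Z z x| <= expR (36 / 2 ^+ N) + C / 2 ^+ N.
Proof.
(* [A] bounds the factor of [node_prod_close] at [J = 7], uniformly in the ratio [t] of two
   consecutive lengths. *)
have [A [A0 AP]] : exists A : R, 0 <= A /\ forall t : R, 0 <= t <= 1 ->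
    3 ^+ (2 ^ 7 - 1) * expR (9 * (2 ^+ 7 * t)) <= A.
  exists (3 ^+ (2 ^ 7 - 1) * expR (9 * (2 ^+ 7 * 1))); split.
    by rewrite mulr_ge0 ?expR_ge0 ?exprn_ge0.
  move=> t /andP[t0 t1]; rewrite ler_wpM2l ?exprn_ge0 // ler_expR.
  by rewrite !ler_wpM2l ?exprn_ge0.
(* With [q = 2^-1 ^+ N]: fewer than [2 ^ 7] close nodes contribute [3 * A * r] each, where
   [r <= 4 * q]; the fewer than [2 ^+ 9 / q] others contribute [9 * e] each, where
   [e <= 4 * (q * q)]. *)
exists (3 * A * 2 ^+ 7 * 4 + 9 * 2 ^+ 9 * 4); split.
  by rewrite addr_ge0 ?mulr_ge0 ?exprn_ge0.
move=> N f Z x; set s := (N + 9)%N => fP f_inj ZE Kx.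
have sE7 : s = (7 + N.+2)%N by rewrite /s addnC !addnS addSn.
have sE3 : s = (N + 6).+3 by rewrite /s -!addnS.
have sub1 h : (s - h.+1 <= N + 8)%N by lia.
have sub7 h : (7 <= h)%N -> (s - h.+1 <= N.+1)%N by lia.
have [i ilt xi] := cantor_level_index (Kx s Logic.I).
pose r := ell (N + 9)%N / ell (N + 8)%N.
pose e : R := (2 / 3) ^+ (2 ^ N).
have r_ge0 : 0 <= r by rewrite divr_ge0 // ltW.
have e_ge0 : 0 <= e by rewrite exprn_ge0 // divr_ge0.
have re : r <= e := ell_ratio_small N.
have ratio_ge0 j : (j < 2 ^ s)%N ->
    0 <= node_prod f s i x / node_prod f s j (f j).
  move=> jlt; apply: divr_ge0; apply/ltW/(node_prod_gt0 ell_gt0 ell3 fP) => //.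
  exact: fP.
have ratio_le j c : (j < 2 ^ s)%N ->
    node_prod f s i x <= c * node_prod f s j (f j) ->
    node_prod f s i x / node_prod f s j (f j) <= c.
  move=> jlt; rewrite ler_pdivrMr //.
  by apply: (node_prod_gt0 ell_gt0 ell3 fP) => //; exact: fP.
have near : `|lagrange_basis Z (f i) x| <= expR (9 * r).
  rewrite (norm_lagrange_near f_inj ZE) //; apply: ratio_le => //.
  have := node_prod_close ell_gt0 ell3 fP (J := 0) (n := N + 8) _ ilt ilt xi
    (fP _ ilt) erefl.
  by rewrite expr0 !mul1r -addnS; apply.
have xfi : `|x - f i| <= ell s.
  have := fP _ ilt; move: xi; rewrite !basic_itvE => /andP[? ?] /andP[? ?].
  by rewrite ler_norml; apply/andP; split; lra.
have far h : (h < s)%N ->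
    block (idx := 0) +%R (fun j => `|lagrange_basis Z (f j) x|) h
      (sib (i %/ 2 ^ h)) <=
    (if (h < 7)%N then 3 * A * r else 9 * e) *+ (2 ^ h).
  move=> hs; apply: block_sum_le => j jE.
  have sE : s = (h + (s - h.+1).+1)%N by rewrite subnSK // subnKC // ltnW.
  have jlt : (j < 2 ^ s)%N.
    by rewrite sE; apply: sib_block_lt jE; rewrite -sE.
  have ij : i != j.
    apply: contra_eq_neq jE => <-; apply/eqP => /(congr1 odd).
    by rewrite odd_sib; case: odd.
  rewrite (norm_lagrange_far ell_gt0 ell3 fP f_inj ZE ilt jlt ij xi).
  have /andP[xfj _] := dist_sib_node ell_gt0 ell3 fP sE ilt xi jE.
  (* Used with [m = N + 8] below height 7, and with [m = N.+1], the largest possible level, from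
     height 7 on. *)
  have dist_le m : (s - h.+1 <= m)%N ->
      `|x - f i| / `|x - f j| <= 3 * (ell s / ell m).
    move=> hm; have em := ell_anti ell_gt0 ell3 hm.
    rewrite ler_pdivrMr; last first.
      by apply: lt_le_trans xfj; rewrite divr_gt0.
    apply: (le_trans xfi); have -> : 3 * (ell s / ell m) * `|x - f j| =
      ell s * (`|x - f j| / (ell m / 3)) by field; rewrite gt_eqF.
    rewrite ler_peMr ?(ltW (ell_gt0 _)) // ler_pdivlMr ?divr_gt0 // mul1r.
    by apply: le_trans xfj; rewrite ler_wpM2r.
  have ij1 : (i %/ 2 ^ h.+1 = j %/ 2 ^ h.+1)%N.
    by rewrite !divn_expS jE half_sib.
  case: ifPn => [h7|].
    have -> : 3 * A * r = 3 * r * A by ring.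
    apply: ler_pM; rewrite ?ratio_ge0 ?divr_ge0 //.
      exact: (dist_le (N + 8)%N (sub1 h)).
    apply: ratio_le => //.
    have ij7 : (i %/ 2 ^ 7 = j %/ 2 ^ 7)%N.
      by rewrite -(subnKC h7) expnD !divnMA ij1.
    apply: le_trans (node_prod_close ell_gt0 ell3 fP sE7 ilt jlt xi
      (fP _ jlt) ij7) _.
    rewrite ler_wpM2r //.
      by apply/ltW/(node_prod_gt0 ell_gt0 ell3 fP) => //; exact: fP.
    apply: AP; rewrite divr_ge0 ?(ltW (ell_gt0 _)) //= ler_pdivrMr // mul1r.
    exact: ell_anti.
  rewrite -leqNgt => h7.
  have osc := ratio_le j _ jlt
    (node_prod_osc ell_gt0 ell3 fP ell_sq sE3 ilt jlt xi (fP _ jlt)).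
  apply: le_trans (ler_pM _ _ (dist_le N.+1 (sub7 _ h7)) osc) _;
    rewrite ?ratio_ge0 ?divr_ge0 //.
  have -> a b : 3 * a * (3 * b) = 9 * (a * b) :> R by ring.
  by rewrite ler_wpM2l // ell_79_small.
have := expr_two_thirds_le R N; rewrite -/e => e4'; clearbody r e.
rewrite (sum_nodes ZE) (bigD1_seq i) ?iota_uniq ?mem_index_iota //=.
rewrite big_sib //.
have [q q0] : exists q : R, q = 2^-1 ^+ N by exists (2^-1 ^+ N).
have e4 : e <= 4 * (q * q).
  move: e4'; have -> : 4 ^+ N = 2 ^+ N * 2 ^+ N :> R.
    by rewrite -exprMn; congr (_ ^+ _); ring.
  by rewrite invfM -exprVn -q0.
have q_gt0 : 0 < q by rewrite q0 exprn_gt0.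
have q_le1 : q <= 1 by rewrite q0 exprn_ile1 //; lra.
rewrite -exprVn -q0; apply: lerD.
  apply: (le_trans near); rewrite ler_expR; nra.
apply: (@le_trans _ _ (3 * A * r * 2 ^+ 7 + 9 * e * 2 ^+ s)).
  rewrite sE7 big_split_ord /=; apply: lerD.
    apply: (@le_trans _ _ (\sum_(h < 7) (3 * A * r) *+ (2 ^ h))).
      apply: ler_sum => -[h h7] _ /=; have := far h; rewrite h7.
      by apply; rewrite sE7 ltn_addr.
    rewrite sum_mulrn_pow2 -[leLHS]mulr_natr ler_wpM2l ?mulr_ge0 //.
    by rewrite -natrX ler_nat leq_subr.
  apply: (@le_trans _ _ (\sum_(h < 7 + N.+2) (9 * e) *+ (2 ^ h))).
    rewrite [leRHS]big_split_ord /= -[leLHS]add0r; apply: lerD.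
      by apply: sumr_ge0 => h _; rewrite mulrn_wge0 // mulr_ge0.
    apply: ler_sum => -[h hN] _ /=; have := far (7 + h)%N.
    have /negbTE -> : ~~ (7 + h < 7)%N by rewrite -leqNgt leq_addr.
    by apply; rewrite sE7 ltn_add2l.
  rewrite sum_mulrn_pow2 -[leLHS]mulr_natr ler_wpM2l ?mulr_ge0 //.
  by rewrite -natrX ler_nat leq_subr.
have -> : 2 ^+ s = 2 ^+ 9 / q :> R by rewrite q0 exprVn invrK -exprD addnC.
have p7 : 0 <= 2 ^+ 7 :> R by rewrite exprn_ge0.
have p9 : 0 <= 2 ^+ 9 :> R by rewrite exprn_ge0.
rewrite [leRHS]mulrDl; apply: lerD.
  have rq : r <= 4 * q by nra.
  have -> : 3 * A * r * 2 ^+ 7 = 3 * A * 2 ^+ 7 * r by ring.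
  by rewrite -[leRHS]mulrA ler_wpM2l ?mulr_ge0.
have -> : 9 * e * (2 ^+ 9 / q) = 9 * 2 ^+ 9 * (e / q) by ring.
rewrite -[leRHS]mulrA ler_wpM2l ?mulr_ge0 // ler_pdivrMr //.
by rewrite -mulrA.
Qed.

End SuperSquareLengths.

(** * Lower bound *)

Lemma blockE (T : Type) (idx : T) (op : Monoid.law idx) (F : nat -> T) h p :
  block (idx := idx) op F h p = \big[op/idx]_(t < 2 ^ h) F (p * 2 ^ h + t)%N.
Proof.
rewrite /block -[X in index_iota X]add0n big_addn mulSn addnK big_mkord.
by apply: eq_bigr => t _; rewrite addnC.
Qed.

Section LowerBound.
Variables (R : realType) (ell : nat -> R).
Hypothesis ell0 : ell 0%N = 1.
Hypothesis ell_gt0 : forall m, 0 < ell m.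
Hypothesis ell3 : forall m, 3 * ell m.+1 <= ell m.
Variables (f : nat -> R) (n : nat).

Local Notation s := n.+2.
Local Notation I := (basic_interval ell).
Local Notation L := (left_endpoint ell).

Hypothesis fP : forall j, (j < 2 ^ s)%N -> f j \in I s j.

(* The last interval of level [s] in the left half of the Cantor set, which is
   the mirror image of the first one in that half. *)
Local Notation j0 := (2 ^ n.+1 - 1)%N.

Lemma left_endpoint_ge0 m j : 0 <= L m j.
Proof.
elim: m j => //= m IH j; have := IH j./2.
by have := ell3 m; have := ell_gt0 m.+1; case: odd; lra.
Qed.

Lemma left_endpoint_half_mirror k : (k < 2 ^ n.+1)%N ->
  L s (j0 - k) = ell 1%N - ell s - L s k.
Proof.
by move=> klt; have := left_endpoint_mirror ell 1 klt; rewrite addn1.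
Qed.

(** Reflecting the left half sends node index [k] to [j0 - k] and the sibling block of [0] to that
    of [j0]. Corresponding distances differ by at most [2 * ell s], the slack inside intervals of
    level [s], against a distance of at least [ell m / 3]. *)
Lemma sib_prod_mirror h x z : (h <= n)%N -> x \in I s 0 -> z \in I s j0 ->
  sib_prod f h j0 z <=
  expR (6 * (2 ^+ h * (ell s / ell (s - h.+1)%N))) * sib_prod f h 0 x.
Proof.
move=> hn x0 zj; have sE : s = (h + (s - h.+1).+1)%N by lia.
set m := (s - h.+1)%N in sE *.
have p2 : (2 ^ h.+1 <= 2 ^ n.+1)%N by rewrite leq_exp2l.
have e2 := expn_gt0 2 h; rewrite expnS /= in p2.
have sibE : sib (j0 %/ 2 ^ h) = (2 ^ (n.+1 - h) - 2)%N.
  have -> : (j0 %/ 2 ^ h = 2 ^ (n.+1 - h) - 1)%N.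
    apply/eqP; rewrite -divn_block.
    have -> : (2 ^ n.+1 = 2 ^ (n.+1 - h) * 2 ^ h)%N.
      by rewrite -expnD subnK // leqW.
    have := expn_gt0 2 (n.+1 - h).
    by move: (2 ^ (n.+1 - h))%N (2 ^ h)%N e2 => a b ? ?; nia.
  have -> : (n.+1 - h = (n - h).+1)%N by lia.
  have := expn_gt0 2 (n - h); rewrite expnS /sib.
  by move: (2 ^ (n - h))%N => a /= a0; case: ifP; lia.
have sib0 : sib (0 %/ 2 ^ h) = 1%N by rewrite div0n.
have zE : sib_prod f h j0 z =
    block (idx := 1) *%R (fun k => `|z - f (j0 - k)%N|) h 1.
  (* The reflection reverses the order inside the block. *)
  rewrite /sib_prod sibE !blockE (reindex_inj rev_ord_inj) /=.
  apply: eq_bigr => -[t th] _ /=; congr `|_ - f _|.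
  have : (2 ^ (n.+1 - h) * 2 ^ h = 2 ^ n.+1)%N by rewrite -expnD subnK // leqW.
  move: p2 th; rewrite mulnBl mul1n; move: (2 ^ (n.+1 - h) * 2 ^ h)%N => a.
  by move: (2 ^ n.+1)%N (2 ^ h)%N => b c; lia.
have -> : expR (6 * (2 ^+ h * (ell s / ell m))) =
    block (idx := 1) *%R (fun=> expR (6 * (ell s / ell m))) h 1.
  rewrite /block prodr_const_nat -mulnBl subSnn mul1n -expRM_natl -natrX.
  by congr expR; ring.
rewrite zE /sib_prod sib0 /block -big_split /= big_nat [leRHS]big_nat.
apply: ler_prod => k; rewrite divn_block => /eqP kE; rewrite normr_ge0 /=.
have klt : (k < 2 ^ n.+1)%N.
  have : (1 * 2 ^ h <= k < 2 * 2 ^ h)%N by rewrite divn_block kE.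
  by move=> /andP[_ h1]; apply: leq_trans h1 p2.
have pS : (2 ^ s = 2 * 2 ^ n.+1)%N by rewrite expnS.
have /andP[xk _] : ell m / 3 <= `|x - f k| <= ell m.
  apply: (dist_sib_node ell_gt0 ell3 fP sE _ x0); first by rewrite expn_gt0.
  by rewrite kE sib0.
have es := ell_gt0 s; have em := ell_gt0 m.
have zk : `|z - f (j0 - k)%N| <= `|x - f k| + 2 * ell s.
  have kI : f k \in I s k by apply: fP; lia.
  have kI' : f (j0 - k)%N \in I s (j0 - k) by apply: fP; lia.
  have Lk := left_endpoint_ge0 s k.
  have xk' : L s k - ell s <= `|x - f k|.
    move: kI x0; rewrite !basic_itvE left_endpoint0 => /andP[? ?] /andP[? ?].
    by rewrite distrC; apply: le_trans (ler_norm _); lra.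
  suff : `|z - f (j0 - k)%N| <= L s k + ell s by lra.
  move: kI' zj; rewrite !basic_itvE left_endpoint_half_mirror //.
  have := left_endpoint_half_mirror (expn_gt0 2 n.+1).
  rewrite subn0 left_endpoint0 => -> /andP[? ?] /andP[? ?].
  by rewrite ler_norml; apply/andP; split; lra.
apply: (le_trans zk).
apply: (@le_trans _ _ ((1 + 6 * (ell s / ell m)) * `|x - f k|)); last first.
  by rewrite ler_wpM2r // expR_ge1Dx.
rewrite [leRHS]mulrDl mul1r lerD2l.
have -> : 6 * (ell s / ell m) * `|x - f k| =
  (2 * ell s) * (`|x - f k| / (ell m / 3)) by field; rewrite gt_eqF.
by rewrite ler_peMr ?mulr_ge0 ?(ltW es) // ler_pdivlMr ?divr_gt0 // mul1r.
Qed.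

(** For both points this block is the whole right half. A node there is at distance at most 1 from
    [z], and farther from [x] by [z - x], which is at least [ell 1 / 3]. *)
Lemma sib_prod_top x z : x \in I s 0 -> z \in I s j0 ->
  (1 + ell 1%N / 3) ^+ (2 ^ n.+1) * sib_prod f n.+1 j0 z <=
  sib_prod f n.+1 0 x.
Proof.
move=> x0 zj.
have p := expn_gt0 2 n.+1; rewrite /= in p.
have sE : s = (n.+1 + 1)%N by rewrite addn1.
have sibz : sib (j0 %/ 2 ^ n.+1) = 1%N by rewrite divn_small //; lia.
have sibx : sib (0 %/ 2 ^ n.+1) = 1%N by rewrite div0n.
have zlt : (j0 < 2 ^ s)%N by rewrite (expnS _ n.+1); lia.
have -> : (1 + ell 1%N / 3) ^+ (2 ^ n.+1) =
    block (idx := 1) *%R (fun=> 1 + ell 1%N / 3) n.+1 1.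
  by rewrite /block prodr_const_nat -mulnBl subSnn mul1n.
rewrite /sib_prod sibz sibx /block -big_split /= big_nat [leRHS]big_nat.
have e1 := ell_gt0 1%N; have es := ell_gt0 s.
have es2 : ell s <= ell 2%N by apply: ell_anti.
have e13 := ell3 0; have e23 := ell3 1; rewrite ell0 in e13.
apply: ler_prod => k; rewrite divn_block => /eqP kE.
rewrite mulr_ge0 ?addr_ge0 ?divr_ge0 ?(ltW e1) //=.
have fk : f k \in I 1 1.
  have := sib_nodeP ell_gt0 ell3 fP sE zlt (j := k).
  by rewrite sibz kE; exact.
have z1 : z \in I 1 0.
  have := @basic_itv_ancestor _ _ ell_gt0 ell3 n.+1 1 j0 z.
  by rewrite addn1 => /(_ zj); rewrite divn_small //; lia.
have L11 : L 1 1 = 1 - ell 1%N by rewrite /= ell0 add0r.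
move: fk z1 x0 zj; rewrite !basic_itvE !left_endpoint0 L11.
have := left_endpoint_half_mirror p; rewrite subn0 left_endpoint0 => ->.
move=> /andP[k1 k2] /andP[z1 z2] /andP[x1 x2] /andP[z3 z4].
rewrite (distrC z) (distrC x) !ger0_norm; [|lra|lra].
have zx : ell 1%N / 3 <= z - x by lra.
have wz : f k - z <= 1 by lra.
by nra.
Qed.

Lemma node_prod_mirror x z : x \in I s 0 -> z \in I s j0 ->
  (1 + ell 1%N / 3) ^+ (2 ^ n.+1) * node_prod f s j0 z <=
  expR 6 * node_prod f s 0 x.
Proof.
move=> x0 zj.
have zlt : (j0 < 2 ^ s)%N.
  by have := expn_gt0 2 n.+1; rewrite (expnS _ n.+1); lia.
have p0 : (0 < 2 ^ s)%N by rewrite expn_gt0.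
rewrite /node_prod !(big_ord_recr n.+1) /= mulrCA [leRHS]mulrA; apply: ler_pM.
- by apply: prodr_ge0 => -[h hn] _; apply/ltW/(sib_prod_gt0 ell_gt0 ell3 fP);
    rewrite //= ltnW.
- rewrite mulr_ge0 //.
    by rewrite exprn_ge0 // addr_ge0 ?divr_ge0 ?(ltW (ell_gt0 _)).
  exact/ltW/(sib_prod_gt0 ell_gt0 ell3 fP).
- pose e h := 6 * (2 ^+ h * (ell s / ell (s - h.+1)%N)).
  apply: (@le_trans _ _ (\prod_(h < n.+1) (expR (e h) * sib_prod f h 0 x))).
    apply: ler_prod => -[h hn] _ /=; rewrite sib_prod_mirror // andbT.
    by apply/ltW/(sib_prod_gt0 ell_gt0 ell3 fP); rewrite //= ltnW.
  rewrite big_split /= ler_wpM2r //.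
    by apply: prodr_ge0 => -[h hn] _; apply/ltW/(sib_prod_gt0 ell_gt0 ell3 fP);
      rewrite //= ltnW.
  rewrite -expR_sum ler_expR.
  have := geometric_ell_sum ell_gt0 ell3 n.+1.
  (* The geometric sum has one more term than there are heights below the top; that nonnegative term
     is dropped. *)
  rewrite big_ord_recr /=; set g := \sum_(_ < _) _ => g3.
  have -> : \sum_(h < n.+1) e h = 6 * (ell s / ell n.+1) * g.
    rewrite mulr_sumr; apply: eq_bigr => -[h hn] _ /=.
    by rewrite /e subSS; field; rewrite !gt_eqF.
  have r3 : ell s / ell n.+1 <= 3^-1.
    by rewrite ler_pdivrMr //; have := ell3 n.+1; lra.
  have r0 : 0 < ell s / ell n.+1 by rewrite divr_gt0.
  have g0 : 0 <= g.
    by apply: sumr_ge0 => h _; rewrite mulr_ge0 ?exprn_ge0 ?divr_ge0 // ltW.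
  have t0 : 0 <= 2 ^+ n.+1 * (ell n.+1 / ell (n.+1 - n.+1)%N).
    by rewrite mulr_ge0 ?exprn_ge0 ?divr_ge0 // ltW.
  by nra.
- exact: sib_prod_top.
Qed.

Variable Z : {fset R}.
Hypothesis f_inj : {in iota 0 (2 ^ s) &, injective f}.
Hypothesis ZE : perm_eq Z [seq f j | j <- iota 0 (2 ^ s)].

(** Of the whole sum only the fundamental polynomial of the mirror node [f j0] is kept. *)
Lemma lebesgue_constant_lower :
  [set` Z] `<=` cantor_set_of ell ->
  expR (- 6) / 2 * (ell s * (1 + ell 1%N / 3) ^+ (2 ^ n.+1)) <=
  lebesgue_constant Z (cantor_set_of ell).
Proof.
move=> ZK.
have p := expn_gt0 2 n; have pS : (2 ^ s = 4 * 2 ^ n)%N by rewrite !expnS mulnA.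
have pS' : (2 ^ n.+1 = 2 * 2 ^ n)%N by rewrite expnS.
have zlt : (j0 < 2 ^ s)%N by lia.
have p0 : (0 < 2 ^ s)%N by lia.
have j00 : 0%N != j0 by lia.
have es := ell_gt0 s.
(* One of the two endpoints of the first interval is at least half its length away from [f 0]. *)
have [x [x0 Kx xf]] : exists x, [/\ x \in I s 0, cantor_set_of ell x &
    ell s / 2 <= `|x - f 0%N|].
  have := fP p0; rewrite basic_itvE left_endpoint0 add0r => /andP[f0 f1].
  have [fle|/ltW fle] := leP (f 0%N) (ell s / 2).
    exists (ell s); split; last by rewrite ger0_norm; lra.
    - by rewrite basic_itvE left_endpoint0 add0r lexx ltW.
    - exact: cantor_set_ell.
  exists 0; split; last by rewrite ler0_norm; lra.
  - by rewrite basic_itvE left_endpoint0 add0r lexx ltW.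
  - exact: cantor_set0.
have K01 y : cantor_set_of ell y -> 0 <= y <= 1 by exact: cantor_set_itv01.
have Z01 z : z \in Z -> 0 <= z <= 1 by move=> /ZK /K01.
apply: le_trans (lebesgue_constant_ge K01 Z01 Kx).
have fjZ : f j0 \in Z by rewrite (perm_mem ZE) map_f // mem_iota.
apply: (@le_trans _ _ `|lagrange_basis Z (f j0) x|); last first.
  by rewrite (big_fsetD1 (f j0)) //= lerDl; apply: sumr_ge0.
rewrite (norm_lagrange_far ell_gt0 ell3 fP f_inj ZE p0 zlt j00 x0).
have Pz : 0 < node_prod f s j0 (f j0).
  by apply: (node_prod_gt0 ell_gt0 ell3 fP) => //; exact: fP.
have ratio : expR (- 6) * (1 + ell 1%N / 3) ^+ (2 ^ n.+1) <=
    node_prod f s 0 x / node_prod f s j0 (f j0).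
  rewrite ler_pdivlMr // expRN -mulrA ler_pdivrMl ?expR_gt0 //.
  by apply: node_prod_mirror => //; exact: fP.
have -> : expR (- 6) / 2 * (ell s * (1 + ell 1%N / 3) ^+ (2 ^ n.+1)) =
  ell s / 2 * (expR (- 6) * (1 + ell 1%N / 3) ^+ (2 ^ n.+1)) by ring.
have /andP[x1 x2] := K01 _ Kx; have /andP[z1 z2] := Z01 _ fjZ.
apply: ler_pM => //.
- by rewrite divr_ge0 // ltW.
- rewrite mulr_ge0 ?expR_ge0 // exprn_ge0 // addr_ge0 // divr_ge0 // ltW //.
- apply: (le_trans xf); rewrite ler_peMr // invf_ge1.
  + by rewrite ler_norml; apply/andP; split; lra.
  + rewrite normr_gt0 subr_eq0; apply: contra_neq j00 => xj.
    apply: (basic_itv_inj ell_gt0 ell3 p0 zlt x0).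
    by rewrite xj fP.
Qed.

End LowerBound.

(** * The lengths of K^alpha *)

Section AlphaLengths.
Variables (R : realType) (alpha ell1 : R).
Hypothesis alpha_gt1 : 1 < alpha.
Hypothesis ell1_gt0 : 0 < ell1.
Hypothesis ell1_le : ell1 <= 3^-1.
Hypothesis ell1_alpha_le : ell1 `^ (alpha - 1) <= 3^-1.

Local Notation ell := (alpha_lengths alpha ell1).

Lemma alpha_lengths_gt0 m : 0 < ell m.
Proof. by case: m => //= m; exact: powR_gt0. Qed.

Lemma alpha_lengths1 : ell 1 = ell1.
Proof. by rewrite /= expr0 powRr1 // ltW. Qed.

Lemma alpha_lengths_ratio m k : k%:R <= alpha ^+ m ->
  3 ^+ k * ell m.+2 <= ell m.+1.
Proof.
move=> km; rewrite /=.
have -> : alpha ^+ m.+1 = alpha ^+ m + (alpha - 1) * alpha ^+ m.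
  by rewrite exprS; ring.
rewrite powRD ?(gt_eqF ell1_gt0) ?implybT // mulrCA ler_piMr ?powR_ge0 //.
rewrite -ler_pdivlMl ?exprn_gt0 // mulr1 powRrM.
have am : 0 <= alpha ^+ m by rewrite exprn_ge0 // (le_trans ler01) // ltW.
apply: (@le_trans _ _ (3^-1 `^ (alpha ^+ m))).
  by apply: ge0_ler_powR => //; rewrite nnegrE ?powR_ge0 ?invr_ge0.
have -> : (3 ^+ k)^-1 = 3^-1 `^ k%:R :> R.
  by rewrite powR_mulrn ?invr_ge0 // exprVn.
by apply: ger_powR => //; lra.
Qed.

Lemma alpha_lengths3 m : 3 * ell m.+1 <= ell m.
Proof.
case: m => [|m]; first by rewrite alpha_lengths1 /=; move: ell1_le; lra.
rewrite -[3]expr1; apply: alpha_lengths_ratio.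
by rewrite exprn_ege1 // ltW.
Qed.

Lemma alpha_lengths_sq m : 2 <= alpha -> 3 ^+ (2 ^ m) * ell m.+2 <= ell m.+1.
Proof.
move=> a2; apply: alpha_lengths_ratio; rewrite natrX.
by apply: lerXn2r; rewrite ?nnegrE //; lra.
Qed.

(** The product is the exponential of [c * 2 ^+ n.+1 - d * alpha ^+ n.+1]; as [alpha < 2], the
    second term is eventually at most half the first. *)
Lemma alpha_lengths_growth (K : R) : 0 < K -> alpha < 2 ->
  K * (ell n.+2 * (1 + ell 1%N / 3) ^+ (2 ^ n.+1)) @[n --> \oo] --> +oo.
Proof.
move=> K0 a2; rewrite alpha_lengths1.
pose c := ln (1 + ell1 / 3); pose d := - ln ell1.
have b1 : 1 < 1 + ell1 / 3 by have := divr_gt0 ell1_gt0 (ltr0n R 3); lra.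
have c0 : 0 < c by rewrite ln_gt0.
have q1 : `|alpha / 2| < 1.
  by move: alpha_gt1 => ?; rewrite ger0_norm; lra.
have /cvgr0_norm_lt small : geometric (d * (alpha / 2)) (alpha / 2) @ \oo --> 0.
  exact: cvg_geometric.
apply/cvgryPge => A; near=> n.
have dn : d * (alpha / 2) ^+ n.+1 <= c / 2.
  apply/ltW/(le_lt_trans (ler_norm _)).
  have -> : d * (alpha / 2) ^+ n.+1 = geometric (d * (alpha / 2)) (alpha / 2) n.
    by rewrite exprS mulrA.
  by near: n; apply: small; rewrite divr_gt0.
have An : A / (K * (c / 2)) <= n%:R.
  by near: n; exact: nbhs_infty_ger.
have -> : ell n.+2 * (1 + ell1 / 3) ^+ (2 ^ n.+1) =
    expR (2 ^+ n.+1 * (c - d * (alpha / 2) ^+ n.+1)).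
  have -> : 2 ^+ n.+1 * (c - d * (alpha / 2) ^+ n.+1) =
      alpha ^+ n.+1 * ln ell1 + 2 ^+ n.+1 * c.
    rewrite expr_div_n /d; field.
    by rewrite expf_neq0.
  rewrite expRD /= /powR gt_eqF // -natrX expRM_natl lnK // posrE; lra.
apply: (@le_trans _ _ (K * (n%:R * (c / 2)))).
  rewrite [n%:R * _]mulrC mulrA -ler_pdivrMl ?mulr_gt0 ?divr_gt0 //.
  by rewrite mulrC.
rewrite ler_pM2l //; apply: le_trans (expR_ge1Dx _).
have n2 : n%:R <= 2 ^+ n.+1 :> R.
  rewrite -natrX ler_nat; apply: leq_trans (ltnW (ltn_expl n (ltnSn 1))) _.
  by rewrite leq_exp2l.
apply: (@le_trans _ _ (2 ^+ n.+1 * (c / 2))).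
  by rewrite ler_wpM2r // divr_ge0 // ltW.
rewrite -[leLHS]add0r lerD // ler_wpM2l ?exprn_ge0 //; lra.
Unshelve. all: by end_near.
Qed.

End AlphaLengths.

Lemma cvg_exp_inv_pow2 (R : realType) (a b : R) :
  expR (a / 2 ^+ n) + b / 2 ^+ n @[n --> \oo] --> (1 : R).
Proof.
have cv0 (t : R) : t / 2 ^+ n @[n --> \oo] --> (0 : R).
  have -> : (fun n => t / 2 ^+ n) = geometric t 2^-1.
    by apply/funext => n /=; rewrite exprVn.
  by apply: cvg_geometric; rewrite ger0_norm; lra.
have cve : expR (a / 2 ^+ n) @[n --> \oo] --> expR (0 : R).
  by apply: continuous_cvg; [exact: continuous_expR | exact: cv0].
by have := cvgD cve (cv0 b); rewrite expR0 addr0; apply.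
Qed.

Theorem theorem4p4 (R : realType) (alpha ell1 : R)
    (alpha_gt1 : 1 < alpha) (ell1_gt0 : 0 < ell1) (ell1_le : ell1 <= 3^-1)
    (ell1_alpha_le : ell1 `^ (alpha - 1) <= 3^-1)
    (Z : nat -> {fset R})
    (card_Z : forall s, #|` Z s| = (2 ^ s)%N)
    (sub_Z : forall s,
      [set` Z s] `<=` cantor_set_of (alpha_lengths alpha ell1))
    (unif_Z : forall s,
      uniformly_distributed (alpha_lengths alpha ell1) (Z s)) :
  (2 <= alpha ->
    lebesgue_constant (Z s) (cantor_set_of (alpha_lengths alpha ell1))
      @[s --> \oo] --> (1 : R)) /\
  (alpha < 2 ->
    lebesgue_constant (Z s) (cantor_set_of (alpha_lengths alpha ell1))
      @[s --> \oo] --> +oo).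
Proof.
pose ell := alpha_lengths alpha ell1.
have ell_gt0 m : 0 < ell m by exact: alpha_lengths_gt0.
have ell3 m : 3 * ell m.+1 <= ell m by exact: alpha_lengths3.
have ell0 : ell 0%N = 1 by [].
have K01 x : cantor_set_of ell x -> 0 <= x <= 1 by exact: cantor_set_itv01.
have nodes s := uniform_nodes ell_gt0 ell3 (card_Z s) (sub_Z s) (unif_Z s).
split=> [alpha_ge2|alpha_lt2].
- have ell_sq m : 3 ^+ (2 ^ m) * ell m.+2 <= ell m.+1.
    exact: alpha_lengths_sq.
  have [C [C0 bound]] := lebesgue_sum_le ell_gt0 ell3 ell_sq.
  (* The upper bound concerns the levels [N + 9] only. *)
  rewrite -(cvg_shiftn 9).
  apply: squeeze_cvgr (cvg_cst _) (cvg_exp_inv_pow2 36 C).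
  apply: nearW => N; apply/andP; split.
    by apply: lebesgue_constant_ge1 => //; rewrite card_Z expn_gt0.
  have [f [_ fP f_inj ZE]] := nodes (N + 9)%N.
  apply: lebesgue_constant_le => [|x Kx].
    by exists 0; exact: cantor_set0.
  exact: bound fP f_inj ZE Kx.
(* The lower bound concerns the levels [n.+2] only. *)
- rewrite -(cvg_shiftn 2).
  have K0 : 0 < expR (- 6) / 2 :> R by rewrite divr_gt0 ?expR_gt0.
  apply: ger_cvgy (alpha_lengths_growth alpha_gt1 ell1_gt0 K0 alpha_lt2).
  apply: nearW => n /=; rewrite addn2.
  have [f [_ fP f_inj ZE]] := nodes n.+2.
  exact: (lebesgue_constant_lower ell0 ell_gt0 ell3 fP f_inj ZE).
Qed.
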